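(* For every Boolean function $f:\{-1,1\}^k\to\{0,1\}$ of the form $f(x)=\textsf{sign}\left(\sum_{i=1}^k \widehat{f}(\{i\})x_i\right)$, $\textsf{Max-CSP}(f)$ is sketching approximable in $O(\log(n))$ space.
   Context: For $z\in\mathbb{R}$, $\textsf{sign}(z)=1$ if $z>0$ and $0$ otherwise. For $S\subseteq[k]$, $\chi_S(x)=\prod_{i\in S}x_i$ (with $\chi_\emptyset\equiv1$) and $\widehat f(S)=\mathbb{E}_{x\sim\mathrm{Unif}(\{-1,1\}^k)}[f(x)\chi_S(x)]$. For $f:\{-1,1\}^k\to\{0,1\}$, an instance $\Psi$ of $\textsf{Max-CSP}(f)$ on Boolean variables $X_1,\dots,X_n\in\{-1,1\}$ consists of constraints, each applying $f$ to a sequence of $k$ literals on $k$ distinct variables (a literal being $X_j$ or $-X_j$); $\textsf{val}_\Psi$ is the maximum over assignments of the fraction of satisfied constraints. Let $\rho(f)=2^{-k}|f^{-1}(1)|$. For $0\le\beta<\gamma\le1$, $(\gamma,\beta)$-$\textsf{Max-CSP}(f)$ is the promise problem of deciding, given $\Psi$ with $\textsf{val}_\Psi\ge\gamma$ or $\textsf{val}_\Psi<\beta$, which holds. Inputs arrive as a stream of constraints; a sketching algorithm is a randomized streaming algorithm using space $s(n)$ whose state (sketch) is composable: for fixed randomness, the sketch of a concatenation of two streams is determined by the sketches of the two streams. It solves a problem if it answers correctly with probability at least $2/3$ on every input. $\textsf{Max-CSP}(f)$ is sketching approximable in space $s(n)$ if there exist $\epsilon>0$ and a sketching algorithm using space $s(n)$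 solving $(1-\epsilon,\rho(f)+\epsilon)$-$\textsf{Max-CSP}(f)$.
   Formalization: Correctness is required only on non-empty instances with at most p(n) constraints, for an arbitrary polynomial p (the O(log n) space may depend on p, epsilon does not), since no composable finite-state sketch works for unbounded streams. *)

(* Defs.v *)
From HB Require Import structures.
From mathcomp Require Import all_boot all_order all_algebra.
From mathcomp Require Import all_classical all_reals all_analysis.
Set Implicit Arguments.
Unset Strict Implicit.
Unset Printing Implicit Defensive.
Import Order.TTheory GRing.Theory Num.Theory.
Import numFieldNormedType.Exports.
Local Open Scope ring_scope.

(* The two-element set {-1, 1} is represented by [bool] through the bijection
   b |-> (-1) ^+ b (so [false] is 1 and [true] is -1); under it, multiplication
   is [addb] and negation is [~~].  The value set {0, 1} of a predicate is
   [bool] with [true] as 1. *)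

Definition pm (R : realType) (b : bool) : R := (-1) ^+ b.

Definition cube (k : nat) : finType := {ffun 'I_k -> bool}.

Definition sign (R : realType) (z : R) : bool := 0 < z.

Definition chi (R : realType) (k : nat) (S : {set 'I_k}) (x : cube k) : R :=
  \prod_(i in S) pm R (x i).

Definition fourier (R : realType) (k : nat) (f : cube k -> bool)
    (S : {set 'I_k}) : R :=
  (2 ^+ k)^-1 * \sum_(x : cube k) (f x)%:R * chi R S x.

Definition rho (R : realType) (k : nat) (f : cube k -> bool) : R :=
  (2 ^+ k)^-1 * #|[set x | f x]|%:R.

(* A constraint: its i-th literal is (j, b), standing for X_j if [b = false]
   and for -X_j if [b = true]; the k variables are distinct. *)
Definition constraint (k n : nat) : finType :=
  {c : {ffun 'I_k -> 'I_n * bool} | injectiveb (fun i => (c i).1)}.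

(* A literal applied to an assignment: X_j times (-1) ^+ b. *)
Definition satisfies (k n : nat) (f : cube k -> bool) (a : cube n)
    (c : constraint k n) : bool :=
  f [ffun i => a (val c i).1 (+) (val c i).2].

Definition sat_fraction (R : realType) (k n : nat) (f : cube k -> bool)
    (Psi : seq (constraint k n)) (a : cube n) : R :=
  (count (satisfies f a) Psi)%:R / (size Psi)%:R.

(* Only used for [Psi] nonempty.  There is at least one assignment and the
   fractions are nonnegative, so the default value 0 is harmless. *)
Definition csp_value (R : realType) (k n : nat) (f : cube k -> bool)
    (Psi : seq (constraint k n)) : R :=
  \big[Num.max/0]_(a : cube n) sat_fraction R f Psi a.

(* A randomized streaming algorithm over the alphabet [A], with an [s]-bit
   memory: a uniformly random string [r] is drawn once, then the algorithm is
   deterministic.  [r] is a read-only random string and is not counted in [s]. *)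
Record streaming_alg (A : Type) (s : nat) := StreamingAlg {
  rand_bits : nat;
  init : rand_bits.-tuple bool -> s.-tuple bool;
  step : rand_bits.-tuple bool -> s.-tuple bool -> A -> s.-tuple bool;
  output : rand_bits.-tuple bool -> s.-tuple bool -> bool }.

Definition sketch (A : Type) (s : nat) (alg : streaming_alg A s)
    (r : (rand_bits alg).-tuple bool) (sigma : seq A) : s.-tuple bool :=
  foldl (step r) (init r) sigma.

Definition composable (A : Type) (s : nat) (alg : streaming_alg A s) : Prop :=
  forall (r : (rand_bits alg).-tuple bool) (sigma sigma' tau tau' : seq A),
    sketch r sigma = sketch r sigma' -> sketch r tau = sketch r tau' ->
    sketch r (sigma ++ tau) = sketch r (sigma' ++ tau').

Definition prob_output (R : realType) (A : Type) (s : nat)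
    (alg : streaming_alg A s) (sigma : seq A) (b : bool) : R :=
  #|[set r : (rand_bits alg).-tuple bool | output r (sketch r sigma) == b]|%:R
  / (2 ^+ rand_bits alg).

(* [alg] solves (gamma, beta)-Max-CSP(f) on nonempty instances with [n]
   variables and at most [m] constraints; [true] means "value >= gamma". *)
Definition solves (R : realType) (k n s : nat) (f : cube k -> bool)
    (gamma beta : R) (m : nat) (alg : streaming_alg (constraint k n) s) : Prop :=
  forall Psi : seq (constraint k n), (0 < size Psi)%N -> (size Psi <= m)%N ->
    (gamma <= csp_value R f Psi -> 2 / 3 <= prob_output R alg Psi true) /\
    (csp_value R f Psi < beta -> 2 / 3 <= prob_output R alg Psi false).

(* The space bound [s] depends on [n] only, so stream lengths are taken to be
   polynomially bounded in [n], by an arbitrary polynomial [p].  Some bound on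
   the length is necessary: on streams of unbounded length over a fixed [n], a
   composable sketch with finitely many states cannot compare multiplicities
   of constraints. *)
Definition sketching_solvable (R : realType) (k : nat) (f : cube k -> bool)
    (gamma beta : R) (s : nat -> nat) (p : {poly nat}) : Prop :=
  exists alg : forall n : nat, streaming_alg (constraint k n) (s n),
    forall n : nat,
      composable (alg n) /\ solves f gamma beta p.[n] (alg n).

(* [space] is a class of space bounds, such as O(log n). *)
Definition sketching_approximable (R : realType) (k : nat) (f : cube k -> bool)
    (space : (nat -> nat) -> Prop) : Prop :=
  exists eps : R, [/\ 0 < eps, rho R f + eps < 1 - eps &
    forall p : {poly nat}, exists s : nat -> nat,
      space s /\ sketching_solvable f (1 - eps) (rho R f + eps) s p].

Local Open Scope classical_set_scope.

Definition O_log (R : realType) (s : nat -> nat) : Prop :=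
  (fun n : nat => (s n)%:R : R^o) =O_\oo (fun n : nat => ln (n%:R : R) : R^o).

(* Main.v *)
Require Import Defs.
From mathcomp Require Import all_boot all_order all_algebra.
From mathcomp Require Import all_classical all_reals all_analysis.
From mathcomp Require Import ring lra zify.
Set Implicit Arguments.
Unset Strict Implicit.
Unset Printing Implicit Defensive.
Import Order.TTheory GRing.Theory Num.Theory.
Local Open Scope ring_scope.

(* The integers W_i = 2 ^ k fourier f {i} give every variable X_j a bias v_j, the
   sum of the signed weights of its occurrences, and the l1 norm N = sum |v_j|
   separates the two cases of the promise problem for m constraints.  An
   assignment satisfying almost all constraints has sum v_j a_j >= m / 2, because
   an integer linear form that is positive is at least 1; hence N >= m / 2.
   Conversely, rounding X_j independently to the sign of v_j with bias eta yields
   in expectation a fraction rho + eta N / (2 ^ k m) - O(eta ^ 2), so a value below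
   rho + eta ^ 2 forces N = O(eta m).

   Since the gap between the two cases can be made any constant, a crude linear
   sketch of N suffices: S = sum v_j e_j Y_j with random signs e_j and magnitudes
   Y_j with P(Y_j >= t) of order 1 / t.  Truncating at th and applying Chebyshev,
   P(|S| >= th) = O(N / th); and with constant probability some |v_j| Y_j is at
   least N, in which case |S| >= N for one of the two signs e_j.  The test |S| >= m / 2 is
   repeated eleven times, and one success is enough to accept. *)

(** * Uniform probability on finite types *)

Definition mean (R : realFieldType) (W : finType) (F : W -> R) : R :=
  (\sum_w F w) / #|W|%:R.

Definition prob (R : realFieldType) (W : finType) (A : pred W) : R :=
  mean (fun w => (A w)%:R).

Lemma probE (R : realFieldType) (W : finType) (A : pred W) :
  prob R A = #|A|%:R / #|W|%:R.
Proof.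
by rewrite /prob /mean -natr_sum -big_mkcond sum1_card.
Qed.

Lemma mean_ge0 (R : realFieldType) (W : finType) (F : W -> R) :
  (forall w, 0 <= F w) -> 0 <= mean F.
Proof. by move=> F0; rewrite divr_ge0 ?sumr_ge0. Qed.

Lemma ler_mean (R : realFieldType) (W : finType) (F G : W -> R) :
  (forall w, F w <= G w) -> mean F <= mean G.
Proof. by move=> FG; rewrite ler_wpM2r ?invr_ge0 ?ler_sum. Qed.

Lemma eq_mean (R : realFieldType) (W : finType) (F G : W -> R) :
  F =1 G -> mean F = mean G.
Proof. by move=> FG; rewrite /mean (eq_bigr G). Qed.

Lemma mean_sum (R : realFieldType) (W I : finType) (F : I -> W -> R) :
  mean (fun w => \sum_i F i w) = \sum_i mean (F i).
Proof. by rewrite /mean exchange_big -mulr_suml. Qed.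

Lemma meanZ (R : realFieldType) (W : finType) (a : R) (F : W -> R) :
  mean (fun w => a * F w) = a * mean F.
Proof. by rewrite /mean -mulr_sumr mulrA. Qed.

Lemma mean_cst (R : realFieldType) (W : finType) (a : R) :
  (0 < #|W|)%N -> mean (fun _ : W => a) = a.
Proof.
move=> W0; rewrite /mean sumr_const -[a *+ _]mulr_natr mulfK //.
by rewrite pnatr_eq0 -lt0n.
Qed.

Lemma le_prob (R : realFieldType) (W : finType) (A B : pred W) :
  subpred A B -> prob R A <= prob R B.
Proof.
by move=> AB; apply: ler_mean => w; rewrite ler_nat; case: (A w) (AB w) => // ->.
Qed.

Lemma probC (R : realFieldType) (W : finType) (A : pred W) :
  (0 < #|W|)%N -> prob R (predC A) = 1 - prob R A.
Proof.
move=> W0; rewrite !probE -[X in _ = X - _](@divff _ #|W|%:R) ?pnatr_eq0 -?lt0n//.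
by rewrite -mulrBl -(cardC A) natrD addrAC subrr add0r.
Qed.

Lemma prob_exists (R : realFieldType) (W I : finType) (A : I -> pred W) :
  prob R (fun w => [exists i, A i w]) <= \sum_i prob R (A i).
Proof.
rewrite -mean_sum; apply: ler_mean => w; case: existsP => [[i Aiw]|_].
  by rewrite (bigD1 i)//= Aiw lerDl sumr_ge0.
by rewrite sumr_ge0.
Qed.

Lemma markov (R : realFieldType) (W : finType) (F : W -> R) (t : R) :
  0 < t -> (forall w, 0 <= F w) -> prob R (fun w => t <= F w) <= mean F / t.
Proof.
move=> t0 F0; rewrite mulrC -meanZ; apply: ler_mean => w.
case: (boolP (t <= F w)) => [tF|_]; first by rewrite mulrC ler_pdivlMr// mul1r.
by rewrite mulr_ge0// invr_ge0 ltW.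
Qed.

(** Independence of the coordinates of a uniform function, by distributing the product over the
    sums. *)
Lemma mean_prod_ffun (R : realFieldType) (I T : finType) (F : I -> T -> R) :
  mean (fun w : {ffun I -> T} => \prod_i F i (w i)) = \prod_i mean (F i).
Proof.
rewrite /mean -bigA_distr_bigA card_ffun natrX big_split/=.
by rewrite prodr_const exprVn.
Qed.

(** Padding the other coordinates with the constant 1 reduces this to [mean_prod_ffun]; the same
    device gives [mean_coord2]. *)
Lemma mean_coord (R : realFieldType) (I T : finType) (g : T -> R) (i : I) :
  (0 < #|T|)%N -> mean (fun w : {ffun I -> T} => g (w i)) = mean g.
Proof.
move=> T0; pose F l t := if l == i then g t else 1.
rewrite (@eq_mean _ _ _ (fun w : {ffun I -> T} => \prod_l F l (w l))) => [|w].
  rewrite mean_prod_ffun (bigD1 i)//= big1 => [|l /negPf li].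
    by rewrite mulr1; apply: eq_mean => t; rewrite /F eqxx.
  by rewrite -[RHS](@mean_cst _ T _ T0); apply: eq_mean => t; rewrite /F li.
by rewrite (bigD1 i)//= /F eqxx big1 ?mulr1// => l /negPf ->.
Qed.

Lemma mean_coord2 (R : realFieldType) (I T : finType) (g h : T -> R) (i j : I) :
  (0 < #|T|)%N -> i != j ->
  mean (fun w : {ffun I -> T} => g (w i) * h (w j)) = mean g * mean h.
Proof.
move=> T0 ij; have ji : j != i by rewrite eq_sym.
pose F l t := if l == i then g t else if l == j then h t else 1.
rewrite (@eq_mean _ _ _ (fun w : {ffun I -> T} => \prod_l F l (w l))) => [|w].
  rewrite mean_prod_ffun (bigD1 i)//= (bigD1 j)//= big1 => [|l /andP[/negPf li /negPf lj]].
    rewrite mulr1; congr (_ * _); apply: eq_mean => t; rewrite /F ?eqxx//.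
    by rewrite (negPf ji).
  by rewrite -[RHS](@mean_cst _ T _ T0); apply: eq_mean => t; rewrite /F li lj.
rewrite (bigD1 i)//= (bigD1 j)//= /F !eqxx (negPf ji) big1 ?mulr1//.
by move=> l /andP[/negPf -> /negPf ->].
Qed.

Lemma prob_forall (R : realFieldType) (I T : finType) (A : I -> pred T) :
  prob R (fun w : {ffun I -> T} => [forall i, A i (w i)]) = \prod_i prob R (A i).
Proof.
rewrite -mean_prod_ffun; apply: eq_mean => w.
case: forallP => [Aw|nA]; first by rewrite big1// => i _; rewrite Aw.
have /existsP[i /negPf ni] : [exists i, ~~ A i (w i)].
  by rewrite -negb_forall; apply/forallP.
by rewrite (bigD1 i)//= ni mul0r.
Qed.

(* Comes from [(1 - p) (1 + p) <= 1]. *)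
Lemma prodr_1B_le (R : realFieldType) (I : finType) (p : I -> R) :
  (forall i, 0 <= p i <= 1) -> \prod_i (1 - p i) <= (1 + \sum_i p i)^-1.
Proof.
move=> p01.
(* Both signs are carried through the induction: together with the bound they yield [P <= 1]. *)
suff [P0 S0 PS] : [/\ 0 <= \prod_i (1 - p i), 0 <= \sum_i p i &
    \prod_i (1 - p i) * (1 + \sum_i p i) <= 1].
  by rewrite -[leRHS]div1r ler_pdivlMr// ltr_wpDr.
elim/big_rec2: _ => [|i S P _ [P0 S0 PS]]; first by rewrite addr0 mulr1.
have /andP[pi0 pi1] := p01 i.
split; [by rewrite mulr_ge0// subr_ge0|by rewrite addr_ge0|].
have P1 : P <= 1 by apply: le_trans PS; rewrite ler_peMr// lerDl.
have h1 : (1 - p i) * (P * (1 + S)) <= 1 - p i by rewrite ler_piMr// subr_ge0.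
have h2 : (1 - p i) * p i * P <= (1 - p i) * p i.
  by rewrite ler_piMr// mulr_ge0// subr_ge0.
have -> : (1 - p i) * P * (1 + (p i + S)) =
    (1 - p i) * (P * (1 + S)) + (1 - p i) * p i * P by ring.
by apply: le_trans (lerD h1 h2) _; have := mulr_ge0 pi0 pi0; lra.
Qed.

Lemma probU (R : realFieldType) (W : finType) (A B : pred W) :
  prob R (predU A B) <= prob R A + prob R B.
Proof.
rewrite !probE -mulrDl ler_wpM2r ?invr_ge0// -natrD ler_nat.
by rewrite -cardUI leq_addr.
Qed.

Lemma mean_snd (R : realFieldType) (U T : finType) (g : T -> R) :
  (0 < #|U|)%N -> mean (fun t : U * T => g t.2) = mean g.
Proof.
move=> U0; rewrite /mean -(pair_big predT predT (fun _ t => g t))/=.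
rewrite sumr_const card_prod natrM -[X in X / _]mulr_natr -mulrA invfM.
by rewrite mulVKf// pnatr_eq0 -lt0n.
Qed.

Lemma mean_random_sign (R : realFieldType) (T : finType) (g : T -> R) :
  mean (fun t : bool * T => (-1) ^+ t.1 * g t.2) = 0.
Proof.
rewrite /mean -(pair_big predT predT (fun (s : bool) t => (-1) ^+ s * g t))/=.
by rewrite big_bool/= -!mulr_sumr expr1 expr0 mulN1r mul1r addNr mul0r.
Qed.

(** * Random combinations with heavy-tailed coefficients *)

(* For [u] uniform in ['I_Q] this has a tail of order [1 / t]: a discrete
   substitute for the absolute value of a Cauchy variable. *)
Definition magnitude (Q : nat) (u : 'I_Q) : nat := Q %/ u.+1.

(** The largest element [u] of [A] confines [A] to an initial segment of length [u.+1]. *)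
Lemma card_ord_le (R : realFieldType) (Q : nat) (A : pred 'I_Q) (B : R) :
  0 <= B -> (forall u, A u -> u.+1%:R <= B) -> #|A|%:R <= B.
Proof.
move=> B0 AB; have [/eqP/pred0P A0|] := posnP #|A|; first by rewrite (eq_card0 A0).
move=> /card_gt0P[u0 Au0]; have [u Au umax] := arg_maxnP (@nat_of_ord Q) Au0.
apply: le_trans (AB u Au); rewrite ler_nat.
rewrite cardE -(size_map val) -(size_iota 0 u.+1) uniq_leq_size//.
  by rewrite map_inj_uniq ?enum_uniq//; exact: val_inj.
move=> _ /mapP[u' + ->]; rewrite mem_enum mem_iota => Au'.
exact: umax.
Qed.

Lemma magnitude_tail_le (R : realFieldType) (Q : nat) (a th : R) :
  (0 < Q)%N -> 0 <= a -> 0 < th ->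
  prob R (fun u : 'I_Q => th < a * (magnitude u)%:R) <= a / th.
Proof.
move=> Q0 a0 th0; rewrite probE card_ord ler_pdivrMr ?ltr0n//.
apply: card_ord_le => [|u /ltW thu]; first by rewrite mulr_ge0// divr_ge0// ltW.
rewrite mulrAC ler_pdivlMr// mulrC.
apply: le_trans (_ : a * (magnitude u)%:R * u.+1%:R <= _).
  by rewrite ler_wpM2r.
by rewrite -mulrA -natrM ler_wpM2l// ler_nat leq_trunc_div.
Qed.

Lemma magnitude_tail_ge (R : realFieldType) (Q a N : nat) :
  (a <= N)%N -> (0 < N)%N -> (N < Q)%N ->
  a%:R / (4 * N%:R) <= prob R (fun u : 'I_Q => N <= a * magnitude u)%N.
Proof.
move=> aN N0 NQ; have [->|a0] := posnP a; first by rewrite mul0r mean_ge0.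
rewrite probE card_ord ler_pdivrMr ?mulr_gt0 ?ltr0n// mulrAC.
rewrite ler_pdivlMr ?ltr0n ?(leq_ltn_trans _ NQ)//.
rewrite -!natrM ler_nat.
(* The least integer with [N < t * a]. The first [Q %/ t] indices have magnitude at least [t]. One
   factor 2 is lost in [t * a <= 2 * N], another in rounding [Q %/ t] down, which needs [t <= Q];
   hence the 4. *)
pose t := (N %/ a).+1.
have ta : (t * a <= 2 * N)%N.
  by rewrite /t mulSn mul2n -addnn addnC leq_add// leq_trunc_div.
have tQ : (t <= Q)%N by rewrite (leq_ltn_trans _ NQ)// leq_div.
have qt : (Q <= 2 * (t * (Q %/ t)))%N.
  have := divn_eq Q t; have := ltn_pmod Q (ltn0Sn _ : (0 < t)%N).
  have : (0 < Q %/ t)%N by rewrite divn_gt0.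
  set q := (Q %/ t)%N; set r := (Q %% t)%N => q0 rt ->.
  by nia.
have qc : (Q %/ t <= #|fun u : 'I_Q => N <= a * magnitude u|)%N.
  have qQ : (Q %/ t <= Q)%N by rewrite leq_div.
  have winj : injective (widen_ord qQ).
    by move=> x y /(congr1 val)/= /val_inj.
  rewrite -[leqLHS]card_ord -[leqLHS](card_imset _ winj).
  apply: subset_leq_card; apply/fintype.subsetP => _ /imsetP[u _ ->].
  rewrite unfold_in /magnitude /=.
  have tu : (t <= Q %/ u.+1)%N by rewrite leq_divRL// mulnC -leq_divRL.
  apply: leq_trans (_ : a * t <= _)%N; last by rewrite leq_mul2l tu orbT.
  by rewrite mulnC ltnW// ltn_ceil.
apply: leq_trans (_ : a * (2 * (t * (Q %/ t))) <= _)%N.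
  by rewrite leq_mul2l qt orbT.
have := leq_mul ta qc; move: #|_| (Q %/ t)%N => c q h.
have -> : (a * (2 * (t * q)) = 2 * (t * a * q))%N by ring.
have -> : (c * (4 * N) = 2 * (2 * N * c))%N by ring.
by rewrite leq_mul2l.
Qed.

(** Heuristically, a tail [a / t] integrated against [2 t] up to [th] gives order [th * a]. Being
    linear in [a], the bound can be summed over the biases. *)
Lemma magnitude_trunc_moment (R : realFieldType) (Q : nat) (a th : R) :
  (0 < Q)%N -> 0 <= a -> 0 < th ->
  mean (fun u : 'I_Q =>
    if a * (magnitude u)%:R <= th then (a * (magnitude u)%:R) ^+ 2 else 0)
  <= 4 * th * a.
Proof.
move=> Q0; rewrite le_eqVlt => /predU1P[<- _|a0 th0].
  rewrite mulr0 /mean big1 ?mul0r// => u _.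
  by rewrite mul0r expr0n/= if_same.
have Q0' : 0 < Q%:R :> R by rewrite ltr0n.
pose B := a * Q%:R; have B0 : 0 < B by rewrite mulr_gt0.
(* [min (th ^ 2) (B / w) ^ 2] is dominated by the increments of [- 1 / (th w + B)]. *)
pose h (j : nat) : R := - (th * j%:R + B)^-1.
have hpos (j : nat) : 0 < th * j%:R + B by rewrite ltr_wpDl// mulr_ge0// ltW.
rewrite /mean card_ord ler_pdivrMr//.
apply: le_trans (_ : \sum_(u < Q) 4 * th * B ^+ 2 * (h u.+1 - h u) <= _).
  apply: ler_sum => u _; set z := a * _.
  have z0 : 0 <= z by rewrite mulr_ge0// ltW.
  have zw : z * u.+1%:R <= B.
    rewrite /z /B -mulrA -natrM ler_wpM2l ?(ltW a0)// ler_nat.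
    exact: leq_trunc_div.
  set d := th * u.+1%:R + B; have d0 : 0 < d by exact: hpos.
  have c0 : 0 < th * u%:R + B by exact: hpos.
  have cd : th * u%:R + B <= d.
    by rewrite /d lerD2r ler_wpM2l ?(ltW th0)// ler_nat.
  have -> : h u.+1 - h u = th / ((th * u%:R + B) * d).
    have dE : d = (th * u%:R + B) + th by rewrite /d -natr1; ring.
    rewrite /h -/d; move: (d) (_ + B) d0 c0 dE => x y x0 y0 ->.
    by field; rewrite !gt_eqF//; lra.
  rewrite mulrA ler_pdivlMr ?mulr_gt0//.
  case: ifP => [zth|_]; last by rewrite mul0r !mulr_ge0 ?ltW// exprn_gt0.
  apply: le_trans (_ : z ^+ 2 * (d * d) <= _).
    by rewrite ler_wpM2l ?sqr_ge0// ler_wpM2r ?(ltW d0).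
  (* One summand of [d] uses [z * u.+1 <= B], the other [z <= th]. *)
  have zd : z * d <= 2 * th * B.
    have : th * (z * u.+1%:R) <= th * B by rewrite ler_wpM2l ?(ltW th0).
    have : z * B <= th * B by rewrite ler_wpM2r ?(ltW B0).
    by rewrite /d; lra.
  have -> : z ^+ 2 * (d * d) = (z * d) ^+ 2 by ring.
  have -> : 4 * th * B ^+ 2 * th = (2 * th * B) ^+ 2 by ring.
  by rewrite ler_pXn2r// nnegrE mulr_ge0// ?mulr_ge0// ltW.
rewrite -mulr_sumr -(big_mkord predT (fun u => h u.+1 - h u)) telescope_sumr//.
apply: le_trans (_ : 4 * th * B ^+ 2 * B^-1 <= _).
  rewrite ler_wpM2l ?mulr_ge0 ?sqr_ge0 ?(ltW th0) ?(ltW a0)// /h mulr0n mulr0 add0r opprK.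
  by rewrite gerDr oppr_le0 invr_ge0 ltW.
by rewrite -[leRHS]mulrA -/B le_eqVlt; apply/orP; left; apply/eqP; field; rewrite gt_eqF.
Qed.

Definition random_comb (Q : nat) (I : finType) (v : I -> int)
    (w : {ffun I -> bool * 'I_Q}) : int :=
  \sum_i v i * ((-1) ^+ (w i).1 * (magnitude (w i).2)%:Z).

Lemma random_comb_tail_le (R : realFieldType) (Q : nat) (I : finType)
    (v : I -> int) (th : R) :
  (0 < Q)%N -> 0 < th ->
  prob R (fun w => th <= `|(@random_comb Q I v w)%:~R|)
  <= 5 * (\sum_i `|v i|)%:~R / th.
Proof.
move=> Q0 th0; pose a i : R := `|v i|%:~R.
have a0 i : 0 <= a i by rewrite ler0z.
have U0 : (0 < #|'I_Q|)%N by rewrite card_ord.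
have B0 : (0 < #|{: bool}|)%N by rewrite card_bool.
have T0 : (0 < #|{: bool * 'I_Q}|)%N by rewrite card_prod muln_gt0 B0.
pose big i (w : {ffun I -> bool * 'I_Q}) := (th < a i * (magnitude (w i).2)%:R).
pose g i (u : 'I_Q) : R :=
  if a i * (magnitude u)%:R <= th then (v i)%:~R * (magnitude u)%:R else 0.
pose Y i (t : bool * 'I_Q) : R := (-1) ^+ t.1 * g i t.2.
pose V (w : {ffun I -> bool * 'I_Q}) := (\sum_i Y i (w i)) ^+ 2.
(* Unless some term exceeds [th], truncation changes nothing and the square of the truncated sum
   reaches [th ^+ 2]. *)
apply: le_trans (_ : prob R (predU (fun w => [exists i, big i w])
    (fun w => th ^+ 2 <= V w)) <= _).
  apply: le_prob => w /= thS; case: existsP => //= nbig.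
  suff -> : V w = `|(random_comb v w)%:~R| ^+ 2.
    by rewrite ler_pXn2r ?nnegrE ?normr_ge0 ?(ltW th0).
  rewrite real_normK ?num_real// /V /random_comb rmorph_sum; congr (_ ^+ 2).
  apply: eq_bigr => i _; rewrite /Y /g ifT; last first.
    by rewrite leNgt; apply/negP => ib; apply: nbig; exists i.
  by rewrite !rmorphM rmorph_sign/= mulrCA.
apply: le_trans (probU _ _ _) _.
(* 5 = 1 + 4: the union bound over large terms, then the truncated second moment. *)
have -> : 5 * (\sum_i `|v i|)%:~R / th =
    (\sum_i a i) / th + (4 * th * \sum_i a i) / th ^+ 2.
  by rewrite rmorph_sum/=; field; rewrite gt_eqF.
apply: lerD.
  apply: le_trans (prob_exists _ _) _; rewrite mulr_suml ler_sum// => i _.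
  rewrite /big /prob (mean_coord (fun t => (th < a i * (magnitude t.2)%:R)%R%:R))//.
  by rewrite (mean_snd (fun u => (th < a i * (magnitude u)%:R)%R%:R))// magnitude_tail_le.
apply: le_trans (markov _ _) _; [by rewrite exprn_gt0|by move=> w; exact: sqr_ge0|].
rewrite ler_wpM2r ?invr_ge0 ?sqr_ge0// mulr_sumr.
have mY i : mean (Y i) = 0 by exact: mean_random_sign.
(* Off-diagonal products vanish in mean, since the signs are independent and centred. *)
rewrite (@eq_mean _ _ _ (fun w : {ffun I -> bool * 'I_Q} =>
    \sum_i \sum_j Y i (w i) * Y j (w j))); last first.
  by move=> w; rewrite /V expr2 mulr_suml; apply: eq_bigr => i _; rewrite mulr_sumr.
rewrite mean_sum ler_sum// => i _; rewrite mean_sum (bigD1 i)//= big1 ?addr0 => [|j ji].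
  rewrite (mean_coord (fun t => Y i t * Y i t))//.
  rewrite (@eq_mean _ _ _ (fun t : bool * 'I_Q => g i t.2 ^+ 2)) => [|t]; last first.
    by rewrite /Y -expr2 exprMn sqrr_sign mul1r.
  rewrite (mean_snd (fun u => g i u ^+ 2))//.
  apply: le_trans (magnitude_trunc_moment Q0 (a0 i) th0); apply: ler_mean => u.
  rewrite /g; case: ifP => _; last by rewrite expr0n.
  by rewrite !exprMn ler_wpM2r ?sqr_ge0// /a intr_norm real_normK ?num_real.
by rewrite mean_coord2// ?mY ?mul0r// eq_sym.
Qed.

Lemma mean_inj (R : realFieldType) (W : finType) (h : W -> W) (F : W -> R) :
  injective h -> mean (fun w => F (h w)) = mean F.
Proof. by move=> hi; rewrite /mean [in RHS](reindex_inj hi). Qed.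

(* With constant probability a single term reaches [N]; flipping the sign of
   such a term turns a small sum into a large one. *)
Lemma random_comb_tail_ge (R : realFieldType) (Q : nat) (I : finType)
    (v : I -> int) (N : nat) :
  N%:Z = \sum_i `|v i| -> (0 < N)%N -> (N < Q)%N ->
  10^-1 <= prob R (fun w => N%:Z <= `|@random_comb Q I v w|).
Proof.
move=> Nv N0 NQ; pose T : finType := (bool * 'I_Q)%type.
have Q0 : (0 < Q)%N by exact: ltn_trans NQ.
have U0 : (0 < #|'I_Q|)%N by rewrite card_ord.
have B0 : (0 < #|{: bool}|)%N by rewrite card_bool.
have T0 : (0 < #|T|)%N by rewrite card_prod muln_gt0 B0.
pose big i (t : T) := (N <= `|v i| * magnitude t.2)%N.
pose A (w : {ffun I -> T}) := N%:Z <= `|random_comb v w|.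
pose toggle i (w : {ffun I -> T}) : {ffun I -> T} :=
  [ffun j => if j == i then (~~ (w j).1, (w j).2) else w j].
(* Whether a term is big does not depend on its sign, so the same coordinate is picked after the
   flip. Thus [flip] is an involution and preserves the uniform measure. *)
pose flip (w : {ffun I -> T}) :=
  if [pick i | big i (w i)] is Some i then toggle i w else w.
have toggleK i : involutive (toggle i).
  move=> w; apply/ffunP => j; rewrite !ffunE; case: eqP => //= _.
  by rewrite negbK -surjective_pairing.
have pick_toggle i w : [pick j | big j (toggle i w j)] = [pick j | big j (w j)].
  by apply: eq_pick => j /=; rewrite /big ffunE; case: eqP.
have flipK : involutive flip.
  move=> w; rewrite {2}/flip; case E: [pick _ | _] => [i|]; last by rewrite /flip E.
  by rewrite /flip pick_toggle E toggleK.
(* The two sums differ by [2 * z] with [|z| >= N], so they cannot both be smaller than [N] in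
   absolute value. *)
have flipA (w : {ffun I -> T}) : [exists i, big i (w i)] -> A w || A (flip w).
  move=> /existsP[i0 bi0]; rewrite /flip; case: pickP => [i bi|/(_ i0)]; last by rewrite bi0.
  set z := v i * ((-1) ^+ (w i).1 * (magnitude (w i).2)%:Z).
  have Nz : N%:Z <= `|z|.
    by rewrite -abszE lez_nat !abszM abszX exp1n mul1n.
  have Sf : random_comb v (toggle i w) = random_comb v w - 2 * z.
    rewrite /random_comb (bigD1 i)//= [in RHS](bigD1 i)//= !ffunE eqxx/= -/z.
    rewrite signrN mulNr mulrN -/z (eq_bigr (fun j =>
      v j * ((-1) ^+ (w j).1 * (magnitude (w j).2)%:Z))); first by ring.
    by move=> j /negPf ji; rewrite ffunE ji.
  rewrite /A Sf; case: leP => //= Sw.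
  by lia.
have p_ge i : `|v i|%:~R / (4 * N%:R) <= prob R (big i).
  rewrite /prob (mean_snd (fun u => (N <= `|v i| * magnitude u)%N%:R))//.
  rewrite -abszE magnitude_tail_ge//.
  rewrite -lez_nat Nv abszE (bigD1 i)//= lerDl sumr_ge0//.
have N0' : 0 < N%:R :> R by rewrite ltr0n.
have sum_p : 4^-1 <= \sum_i prob R (big i).
  apply: le_trans (ler_sum _ (fun i _ => p_ge i)).
  rewrite -mulr_suml -rmorph_sum -Nv/= invfM mulrCA.
  by rewrite -[N%:~R]/(N%:R) mulfV ?gt_eqF// mulr1.
have WT0 : (0 < #|{ffun I -> T}|)%N by rewrite card_ffun expn_gt0 T0.
(* The constant is [1 - 1 / (1 + 1/4)]; sharing it between [w] and [flip w] leaves 1/10. *)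
have E_ge : 5^-1 <= prob R (fun w : {ffun I -> T} => [exists i, big i (w i)]).
  set e := prob R (fun w => _).
  have qe : \prod_i (1 - prob R (big i)) = 1 - e.
    rewrite -probC//; under eq_bigr do rewrite -probC//.
    by rewrite -prob_forall; apply: eq_mean => w; rewrite /= negb_exists.
  have p01 i : 0 <= prob R (big i) <= 1.
    rewrite mean_ge0//= -subr_ge0 -probC//; exact: mean_ge0.
  have := prodr_1B_le p01.
  set s := \sum_i _ in sum_p *; move: qe; set q := \prod_i _ => qe qs.
  have s1 : 0 < 1 + s by lra.
  have q1 : q * (1 + s) <= 1 by rewrite -ler_pdivlMr// div1r.
  have q0 : 0 <= q by apply: prodr_ge0 => i _; rewrite subr_ge0; case/andP: (p01 i).
  have : q * 4^-1 <= q * s by rewrite ler_wpM2l.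
  by lra.
have : prob R (fun w : {ffun I -> T} => [exists i, big i (w i)]) <=
    prob R A + prob R (fun w => A (flip w)).
  by apply: le_trans (probU _ _ _); apply: le_prob => w /flipA.
rewrite [X in _ + X](mean_inj (fun w => (A w)%:R) (can_inj flipK)) -/(prob R A).
by rewrite -/A; lra.
Qed.

(** * Biases of variables and the value of an instance *)

Definition int_weight (k : nat) (f : cube k -> bool) (i : 'I_k) : int :=
  \sum_(x : cube k) (f x)%:R * (-1) ^+ (x i).

Definition bias (k n : nat) (f : cube k -> bool) (Psi : seq (constraint k n))
    (j : 'I_n) : int :=
  \sum_(c <- Psi) \sum_(i < k | (val c i).1 == j)
    int_weight f i * (-1) ^+ (val c i).2.

Lemma card_cube (k : nat) : #|cube k| = (2 ^ k)%N.
Proof. by rewrite card_ffun card_bool card_ord. Qed.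

Lemma int_weightE (R : realType) (k : nat) (f : cube k -> bool) (i : 'I_k) :
  (int_weight f i)%:~R = 2 ^+ k * fourier R f [set i]%SET.
Proof.
rewrite /fourier mulVKf ?expf_neq0 ?pnatr_eq0// rmorph_sum; apply: eq_bigr => x _.
by rewrite /chi big_set1 rmorphM rmorph_nat rmorph_sign.
Qed.

Lemma int_weight_le (k : nat) (f : cube k -> bool) (i : 'I_k) :
  (`|int_weight f i| <= 2 ^ k)%N.
Proof.
rewrite -lez_nat abszE; apply: le_trans (ler_norm_sum _ _ _) _.
apply: le_trans (_ : \sum_(x : cube k) (1 : int) <= _); last first.
  by rewrite sumr_const card_cube natz.
apply: ler_sum => x _; rewrite normrM normrX normrN1 expr1n mulr1.
by case: (f x).
Qed.

(** Double counting of literal occurrences. The ring is arbitrary because [F] will be an assignment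
    or a random combination over [int], and a rounding bias over the reals. *)
Lemma bias_exchange (R : pzRingType) (k n : nat) (f : cube k -> bool)
    (Psi : seq (constraint k n)) (F : 'I_n -> R) :
  \sum_(c <- Psi) \sum_(i < k)
    (int_weight f i)%:~R * (-1) ^+ (val c i).2 * F (val c i).1 =
  \sum_j (bias f Psi j)%:~R * F j.
Proof.
under [RHS]eq_bigr do rewrite rmorph_sum mulr_suml.
rewrite [RHS]exchange_big/=; apply: eq_bigr => c _.
rewrite (partition_big (fun i => (val c i).1) predT)//=; apply: eq_bigr => j _.
rewrite rmorph_sum mulr_suml; apply: eq_bigr => i /eqP <-.
by rewrite rmorphM rmorph_sign.
Qed.

Lemma linear_form_sat (R : realType) (k : nat) (f : cube k -> bool)
    (hf : forall x : cube k,
       f x = sign (\sum_(i < k) fourier R f [set i]%SET * pm R (x i))) (x : cube k) :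
  f x -> 1 <= \sum_i int_weight f i * (-1) ^+ (x i).
Proof.
rewrite hf /sign -(pmulr_rgt0 _ (_ : 0 < 2 ^+ k)) ?exprn_gt0// mulr_sumr.
rewrite (eq_bigr (fun i => (int_weight f i * (-1) ^+ (x i))%:~R)) => [|i _].
  by rewrite -rmorph_sum ltr0z gtz0_ge1.
by rewrite mulrA -int_weightE rmorphM rmorph_sign.
Qed.

(** The form [\sum_j v_j (-1) ^+ a j] is at most the l1 norm. Each satisfied constraint contributes
    at least 1 to it, and any other at least [- k * 2 ^ k]. *)
Lemma bias_norm_ge (R : realType) (k n : nat) (f : cube k -> bool)
    (hf : forall x : cube k,
       f x = sign (\sum_(i < k) fourier R f [set i]%SET * pm R (x i)))
    (Psi : seq (constraint k n)) (a : cube n) :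
  (count (satisfies f a) Psi)%:Z * (1 + (k * 2 ^ k)%:Z) - (k * 2 ^ k)%:Z * (size Psi)%:Z
  <= \sum_j `|bias f Psi j|.
Proof.
apply: le_trans (_ : \sum_j (bias f Psi j)%:~R * (-1) ^+ a j <= _); last first.
  apply: ler_sum => j _; rewrite intz; apply: le_trans (ler_norm _) _.
  by rewrite normrM normrX normrN1 expr1n mulr1.
rewrite -bias_exchange.
elim: Psi => [|c Psi IH]; first by rewrite big_nil /= mul0r mulr0.
rewrite big_cons/= PoszD.
pose y : cube k := [ffun i => a (val c i).1 (+) (val c i).2].
set T := \sum_(i < k) _.
have TE : T = \sum_i int_weight f i * (-1) ^+ (y i).
  apply: eq_bigr => i _; rewrite ffunE intz -mulrA; congr (_ * _).
  by rewrite signr_addb mulrC.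
have Tge : - (k * 2 ^ k)%:Z <= T.
  rewrite TE lerNl; apply: le_trans (ler_norm _) _; rewrite normrN.
  apply: le_trans (ler_norm_sum _ _ _) _.
  apply: le_trans (_ : \sum_(i < k) (2 ^ k)%:Z <= _).
    apply: ler_sum => i _.
    by rewrite normrM normrX normrN1 expr1n mulr1 -abszE lez_nat int_weight_le.
  by rewrite sumr_const card_ord -mulr_natl natz PoszM.
have Tsat : satisfies f a c -> 1 <= T by rewrite TE => /(linear_form_sat hf).
move: Tsat Tge IH; move: (k * 2 ^ k)%N (\sum_(j <- Psi) _) => K S.
rewrite -[(size Psi).+1]addn1 !PoszD.
case: satisfies => [/(_ isT) T1|_] Tge IH.
  apply: le_trans (lerD T1 IH); rewrite le_eqVlt; apply/orP; left; apply/eqP.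
  by rewrite (_ : Posz true = 1)//; ring.
apply: le_trans (lerD Tge IH); rewrite le_eqVlt; apply/orP; left; apply/eqP.
by rewrite (_ : Posz false = 0)//; ring.
Qed.

Lemma prod_1D_taylor (R : realFieldType) (I : Type) (s : seq I) (x : I -> R) (eta : R) :
  0 <= eta <= 1 -> (forall i, `|x i| <= eta) ->
  `|\prod_(i <- s) (1 + x i) - 1 - \sum_(i <- s) x i| <= 3 ^+ size s * eta ^+ 2.
Proof.
move=> /andP[e0 e1] xe.
(* The new factor also multiplies the linear part, whose size must therefore be tracked. The base 3
   is 2 from [|1 + x i|] plus 1 absorbing [size s <= 3 ^+ size s]. *)
suff [] : `|\prod_(i <- s) (1 + x i) - 1 - \sum_(i <- s) x i| <= 3 ^+ size s * eta ^+ 2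
  /\ `|\sum_(i <- s) x i| <= (size s)%:R * eta by [].
elim: s => [|i s [IHP IHS]].
  by rewrite !big_nil subrr subr0 normr0 !mul0r expr0 mul1r sqr_ge0.
rewrite !big_cons/=; move: IHP IHS; set P := \prod_(_ <- _) _; set S := \sum_(_ <- _) _.
move=> IHP IHS; split; last first.
  by rewrite -nat1r mulrDl mul1r (le_trans (ler_normD _ _))// lerD.
have -> : (1 + x i) * P - 1 - (x i + S) = (P - 1 - S) * (1 + x i) + x i * S by ring.
apply: le_trans (ler_normD _ _) _; rewrite !normrM.
have h1 : `|1 + x i| <= 2.
  by apply: le_trans (ler_normD _ _) _; rewrite normr1; have := xe i; lra.
have h2 : `|P - 1 - S| * `|1 + x i| <= 3 ^+ size s * eta ^+ 2 * 2 by apply: ler_pM.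
have h3 : `|x i| * `|S| <= eta * ((size s)%:R * eta) by apply: ler_pM.
have h4 : (size s)%:R * eta ^+ 2 <= 3 ^+ size s * eta ^+ 2.
  by rewrite ler_wpM2r ?sqr_ge0// -natrX ler_nat ltnW// ltn_expl.
apply: le_trans (lerD h2 h3) _; rewrite [3 ^+ (size s).+1]exprS.
have -> : eta * ((size s)%:R * eta) = (size s)%:R * eta ^+ 2 by ring.
by rewrite -[leRHS]mulrA; move: (_ ^+ size s * _) h4 => u h4; lra.
Qed.

(** As the variables of a constraint are distinct, a product distribution on assignments induces a
    product distribution on its literals. Only the total mass of each [mu j] matters, so the
    identity is purely algebraic. *)
Lemma product_marginal (R : comNzRingType) (k n : nat) (g : cube k -> R)
    (c : constraint k n) (mu : 'I_n -> bool -> R) :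
  (forall j, \sum_b mu j b = 1) ->
  \sum_(a : cube n) (\prod_j mu j (a j)) *
    g [ffun i => a (val c i).1 (+) (val c i).2] =
  \sum_(z : cube k) g z * \prod_i mu (val c i).1 (z i (+) (val c i).2).
Proof.
move=> mu1; pose lit (z : cube k) i := z i (+) (val c i).2.
have varI : injective (fun i => (val c i).1) by apply/injectiveP; exact: (valP c).
(* Insert the indicator that the literals of [a] read [z], grouped by variable; [lit z i] is the
   value forced on the [i]-th variable. The sum over [a] then factors. *)
transitivity (\sum_(z : cube k) g z * \sum_(a : cube n)
    \prod_j (mu j (a j) * \prod_(i < k | (val c i).1 == j) (a j == lit z i)%:R)).
  under [RHS]eq_bigr do rewrite mulr_sumr.
  rewrite exchange_big/=; apply: eq_bigr => a _.
  rewrite (bigD1 [ffun i => a (val c i).1 (+) (val c i).2])//= [X in _ + X]big1 => [|z zy].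
    rewrite addr0 mulrC big_split/= [X in _ * (_ * X)]big1 ?mulr1// => j _.
    by rewrite big1// => i /eqP <-; rewrite /lit ffunE -addbA addbb addbF eqxx.
  have [i zi] : exists i, z i != a (val c i).1 (+) (val c i).2.
    apply/existsP; apply: contraNT zy; rewrite negb_exists => /forallP h.
    by apply/eqP/ffunP => i; rewrite ffunE; apply/eqP; move: (h i); rewrite negbK.
  rewrite (bigD1 (val c i).1)//= (bigD1 i)//=.
  rewrite [_ == lit z i]negbTE ?mul0r ?mulr0 ?mul0r ?mulr0//.
  apply: contraNN zi => /eqP ->; rewrite /lit -addbA addbb addbF//.
apply: eq_bigr => z _; congr (_ * _).
rewrite -(bigA_distr_bigA (fun j b =>
  mu j b * \prod_(i < k | (val c i).1 == j) (b == lit z i)%:R)).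
rewrite [RHS](partition_big (fun i => (val c i).1) predT)//=; apply: eq_bigr => j _.
(* A variable outside the constraint sums to 1; any other occurs at a single position [i]. *)
case: (pickP (fun i : 'I_k => (val c i).1 == j)) => [i /eqP ij|no]; last first.
  rewrite [RHS]big1 => [|i]; last by rewrite no.
  rewrite -[RHS](mu1 j); apply: eq_bigr => b _.
  by rewrite big1 ?mulr1// => i; rewrite no.
have only l : ((val c l).1 == j) = (l == i).
  by rewrite -ij; apply/eqP/eqP => [/varI|->].
rewrite (eq_bigl _ _ only) big_pred1_eq ij.
under eq_bigr => b _ do rewrite (eq_bigl _ _ only) big_pred1_eq.
rewrite (bigD1 (lit z i))//= eqxx mulr1 big1 ?addr0// => b /negPf ->.
by rewrite mulr0.
Qed.

Lemma rhoE (R : realType) (k : nat) (f : cube k -> bool) :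
  rho R f = (2 ^+ k)^-1 * \sum_(x : cube k) (f x)%:R.
Proof.
by rewrite /rho -natr_sum -big_mkcond sum1_card cardsE.
Qed.

Lemma rho_le1 (R : realType) (k : nat) (f : cube k -> bool) : rho R f <= 1.
Proof.
rewrite /rho mulrC ler_pdivrMr ?exprn_gt0// mul1r -natrX ler_nat -card_cube.
exact: max_card.
Qed.

(** Here [(-1) ^+ a j] has mean [t j]. The probability of satisfaction is [2 ^- k] times the sum of
    [f z] against a product of factors [1 + x z i]; its first-order part in [t] is governed by the
    level-one Fourier coefficients. *)
Lemma biased_literals_mean_ge (R : realType) (k n : nat) (f : cube k -> bool)
    (c : constraint k n) (t : 'I_n -> R) (eta : R) :
  0 <= eta <= 1 -> (forall j, `|t j| <= eta) ->
  rho R f + (2 ^+ k)^-1 * (\sum_(i < k)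
    (int_weight f i)%:~R * (-1) ^+ (val c i).2 * t (val c i).1) - 3 ^+ k * eta ^+ 2 <=
  \sum_(a : cube n) (\prod_j ((1 + t j * (-1) ^+ a j) / 2)) * (satisfies f a c)%:R.
Proof.
move=> eta01 teta.
have mu1 j : \sum_b (1 + t j * (-1) ^+ nat_of_bool b) / 2 = 1 :> R.
  by rewrite big_bool/= expr1 expr0 mulrN1 mulr1; field.
rewrite /satisfies (product_marginal (fun z => (f z)%:R) c mu1).
pose x (z : cube k) i := t (val c i).1 * (-1) ^+ (z i (+) (val c i).2).
have xeta z i : `|x z i| <= eta by rewrite normrM normrX normrN1 expr1n mulr1.
rewrite (eq_bigr (fun z => (2 ^+ k)^-1 *
    ((f z)%:R * \prod_(i < k) (1 + x z i)))) => [|z _]; last first.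
  by rewrite big_split/= prodr_const card_ord exprVn mulrA [LHS]mulrC.
rewrite -mulr_sumr.
apply: le_trans (_ : (2 ^+ k)^-1 * \sum_(z : cube k) (f z)%:R *
    (1 + \sum_(i < k) x z i - 3 ^+ k * eta ^+ 2) <= _); last first.
  rewrite ler_wpM2l ?invr_ge0 ?exprn_ge0//; apply: ler_sum => z _.
  rewrite ler_wpM2l//.
  have := prod_1D_taylor (index_enum 'I_k) eta01 (xeta z).
  have -> : size (index_enum 'I_k) = k.
    by rewrite /index_enum; case: index_enum_key; rewrite /= -enumT size_enum_ord.
  by rewrite ler_norml => /andP[]; lra.
rewrite (eq_bigr (fun z => (f z)%:R * (1 - 3 ^+ k * eta ^+ 2) +
    \sum_(i < k) (f z)%:R * x z i)) => [|z _]; last by rewrite -mulr_sumr; ring.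
rewrite big_split/= -mulr_suml [leRHS]mulrDr [X in _ <= X + _]mulrA -rhoE.
rewrite [X in _ <= _ + _ * X]exchange_big/=.
have -> : \sum_(i < k) \sum_z (f z)%:R * x z i =
    \sum_(i < k) (int_weight f i)%:~R * (-1) ^+ (val c i).2 * t (val c i).1.
  apply: eq_bigr => i _; rewrite rmorph_sum !mulr_suml; apply: eq_bigr => z _.
  by rewrite /x rmorphM rmorph_nat rmorph_sign signr_addb; ring.
rewrite mulrBr mulr1 addrAC lerD2r lerB// ler_piMl ?rho_le1//.
by rewrite mulr_ge0 ?sqr_ge0 ?exprn_ge0.
Qed.

(** The maximum dominates an average over independent variables. Giving [(-1) ^+ a j] mean [eta]
    times the sign of the bias turns the linear term into [eta] times the l1 norm. *)
Lemma csp_value_rounding (R : realType) (k n : nat) (f : cube k -> bool)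
    (Psi : seq (constraint k n)) (eta : R) :
  0 <= eta <= 1 -> (0 < size Psi)%N ->
  rho R f + eta * (\sum_j `|bias f Psi j|)%:~R / (2 ^+ k * (size Psi)%:R)
    - 3 ^+ k * eta ^+ 2 <= csp_value R f Psi.
Proof.
move=> eta01 Psi0; have /andP[eta0 eta1] := eta01.
pose t j : R := eta * Num.sg (bias f Psi j)%:~R.
have teta j : `|t j| <= eta.
  by rewrite normrM ger0_norm// normr_sg ler_piMr//; case: (_ == 0).
pose mu (a : cube n) : R := \prod_j ((1 + t j * (-1) ^+ a j) / 2).
have mu0 a : 0 <= mu a.
  apply: prodr_ge0 => j _; rewrite divr_ge0//.
  have : `|t j * (-1) ^+ a j| <= 1.
    by rewrite normrM normrX normrN1 expr1n mulr1 (le_trans (teta j)).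
  by rewrite ler_norml => /andP[]; lra.
have mu1 : \sum_a mu a = 1.
  rewrite -(bigA_distr_bigA (fun j (b : bool) => (1 + t j * (-1) ^+ b) / 2))/= big1// => j _.
  by rewrite big_bool/= expr1 expr0 mulrN1 mulr1; field.
have m0 : 0 < (size Psi)%:R :> R by rewrite ltr0n.
apply: le_trans (_ : \sum_a mu a * sat_fraction R f Psi a <= _); last first.
  rewrite -[leRHS]mul1r -mu1 mulr_suml; apply: ler_sum => a _.
  by rewrite ler_wpM2l// /csp_value le_bigmax.
rewrite [leRHS](eq_bigr (fun a => mu a * (count (satisfies f a) Psi)%:R / (size Psi)%:R));
  last by move=> a _; rewrite /sat_fraction mulrA.
rewrite -mulr_suml ler_pdivlMr//.
have -> : \sum_a mu a * (count (satisfies f a) Psi)%:R =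
    \sum_(c <- Psi) \sum_a mu a * (satisfies f a c)%:R.
  rewrite exchange_big/=; apply: eq_bigr => a _; rewrite -mulr_sumr.
  by rewrite -natr_sum -big_mkcond sum1_count.
apply: le_trans (_ : \sum_(c <- Psi) (rho R f + (2 ^+ k)^-1 * (\sum_(i < k)
    (int_weight f i)%:~R * (-1) ^+ (val c i).2 * t (val c i).1) - 3 ^+ k * eta ^+ 2) <= _);
  last by apply: ler_sum => c _; exact: biased_literals_mean_ge.
pose s (c : constraint k n) :=
  \sum_(i < k) (int_weight f i)%:~R * (-1) ^+ (val c i).2 * t (val c i).1.
have sE : \sum_(c <- Psi) s c = eta * (\sum_j `|bias f Psi j|)%:~R.
  rewrite /s bias_exchange rmorph_sum mulr_sumr; apply: eq_bigr => j _ /=.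
  by rewrite /t mulrCA [_ * Num.sg _]mulrC -normrEsg intr_norm.
rewrite (eq_bigr (fun c => (2 ^+ k)^-1 * s c + (rho R f - 3 ^+ k * eta ^+ 2)));
  last by move=> c _; rewrite -/(s c) addrCA addrA.
rewrite big_split/= -mulr_sumr sE big_const_seq count_predT iter_addr_0.
rewrite -[(_ - _) *+ _]mulr_natr.
rewrite le_eqVlt; apply/orP; left; apply/eqP; field.
by rewrite expf_neq0 ?pnatr_eq0// gt_eqF.
Qed.

(** * The sketch *)

(** Used to encode counter states and random seeds as bit strings. *)
Lemma card_eq_bij (A B : finType) : #|A| = #|B| ->
  exists f : A -> B, exists g : B -> A, cancel f g /\ cancel g f.
Proof.
move=> AB; exists (fun x => enum_val (cast_ord AB (enum_rank x))).
exists (fun y => enum_val (cast_ord (esym AB) (enum_rank y))).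
by split=> x; rewrite enum_valK ?cast_ordK ?cast_ordKV enum_rankK.
Qed.

Lemma card_bits (b : nat) : #|{: b.-tuple bool}| = (2 ^ b)%N.
Proof. by rewrite card_tuple card_bool. Qed.

(* Counters modulo [2 ^ b]: the sketch is a morphism to a finite group, hence
   composable on streams of any length, and exact as long as no counter wraps. *)
Lemma counter_sketch (A : Type) (W I : finType) (B b s : nat)
    (phi : W -> A -> I -> nat) (D : W -> {ffun I -> nat} -> bool) :
  #|W| = (2 ^ B)%N -> s = (b * #|I|)%N ->
  exists alg : streaming_alg A s, composable alg /\
    forall (R : realType) (sigma : seq A) (ans : bool),
      (forall w i, \sum_(x <- sigma) phi w x i < 2 ^ b)%N ->
      prob_output R alg sigma ans =
      prob R (fun w => D w [ffun i => \sum_(x <- sigma) phi w x i]%N == ans).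
Proof.
move=> cardW ->; pose G := {ffun I -> 'I_(2 ^ b)}.
have b0 : (0 < 2 ^ b)%N by rewrite expn_gt0.
have cardG : #|G| = #|{: (b * #|I|).-tuple bool}|.
  by rewrite card_bits card_ffun card_ord expnM.
have [enc [dec [encK decK]]] := card_eq_bij cardG.
have cardW' : #|{: B.-tuple bool}| = #|W| by rewrite card_bits.
have [rnd [rnd' [rndK rndK']]] := card_eq_bij cardW'.
pose red (F : I -> nat) : G := [ffun i => Ordinal (ltn_pmod (F i) b0)].
pose alg : streaming_alg A (b * #|I|) := @StreamingAlg A (b * #|I|) B
  (fun _ => enc (red (fun _ => 0)%N))
  (fun r st x => enc (red (fun i => dec st i + phi (rnd r) x i)%N))
  (fun r st => D (rnd r) [ffun i => dec st i : nat]).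
have sketchE (r : B.-tuple bool) (sigma : seq A) : @sketch _ _ alg r sigma =
    enc (red (fun i => \sum_(x <- sigma) phi (rnd r) x i)%N).
  rewrite /sketch; elim/last_ind: sigma => [|sigma x IH].
    by congr (enc _); apply/ffunP => i; rewrite !ffunE; apply/val_inj; rewrite /= big_nil.
  rewrite -cats1 foldl_cat /= IH encK; congr (enc _).
  by apply/ffunP => i; rewrite !ffunE; apply/val_inj; rewrite /= big_cat/= big_seq1 modnDml.
exists alg; split.
  move=> r s1 s2 t1 t2; rewrite !sketchE => /(can_inj encK) ss /(can_inj encK) tt.
  congr (enc _); apply/ffunP => i; rewrite !ffunE; apply/val_inj => /=.
  rewrite !big_cat/= -modnDm.
  have := congr1 (fun F : G => F i : nat) ss; rewrite !ffunE /= => ->.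
  have := congr1 (fun F : G => F i : nat) tt; rewrite !ffunE /= => ->.
  by rewrite modnDm.
move=> R sigma ans small; rewrite /prob_output probE cardW natrX; congr (_%:R / _).
have bij : bijective rnd by exists rnd'.
rewrite -[in RHS](on_card_preimset (onW_bij _ bij)); apply: eq_card => r.
rewrite !inE sketchE /= encK; congr (D _ _ == ans).
by apply/ffunP => i; rewrite !ffunE /= modn_small.
Qed.

(** * Polynomial stream lengths and logarithmic space *)

Lemma horner_nat_le (p : {poly nat}) :
  exists C d : nat, forall n, (0 < n)%N -> (p.[n] <= C * n ^ d)%N.
Proof.
elim/poly_ind: p => [|p c [C [d Cd]]].
  by exists 0%N, 0%N => n _; rewrite horner0.
exists (C + c)%N, d.+1 => n n0; rewrite hornerMXaddC mulnDl.
rewrite -[leqLHS]/(p.[n] * n + c)%N leq_add//.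
  by rewrite expnSr mulnA leq_mul2r Cd ?orbT.
by rewrite leq_pmulr// expn_gt0 n0.
Qed.

Lemma trunc_log_poly_bound (p : {poly nat}) (c : nat) :
  exists e : nat, forall n, (1 < n)%N -> (2 ^ (trunc_log 2 (p.[n] * c)).+1 <= n ^ e)%N.
Proof.
have [C [d Cd]] := horner_nat_le p.
(* As [n >= 2], the constant [2 * (C * c).+1] is at most [n ^ (C * c).+2]. *)
exists ((C * c).+1.+1 + d)%N => n n1.
have n0 : (0 < n)%N by exact: ltn_trans n1.
have : (2 ^ trunc_log 2 (p.[n] * c) <= (C * c).+1 * n ^ d)%N.
  have [->|x0] := posnP (p.[n] * c)%N; first by rewrite muln_gt0 expn_gt0 n0.
  apply: leq_trans (trunc_logP _ x0) _ => //.
  by rewrite mulSn (leq_trans _ (leq_addl _ _))// mulnAC leq_mul2r Cd ?orbT.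
move=> h; rewrite expnD expnS; apply: leq_trans (_ : 2 * ((C * c).+1 * n ^ d) <= _)%N.
  by rewrite leq_mul2l.
rewrite mulnA leq_mul2r; apply/orP; right.
by rewrite expnS leq_mul// ltnW// ltn_expl.
Qed.

Lemma O_log_trunc_log (R : realType) (p : {poly nat}) (a c : nat) :
  O_log R (fun n => a * (trunc_log 2 (p.[n] * c)).+1)%N.
Proof.
have [e eb] := trunc_log_poly_bound p c.
have ln2 : 0 < ln (2 : R) by rewrite ln_gt0// ltr1n.
(* The added 1 keeps the constant positive when [a * e] is 0. *)
apply/eqO_exP; exists (a%:R * (e%:R / ln 2) + 1).
  by rewrite ltr_wpDl// mulr_ge0// divr_ge0// ltW.
near=> n.
have n1 : (1 < n)%N by near: n; exact: nbhs_infty_gt.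
have lnn : 0 <= ln (n%:R : R) by rewrite ln_ge0// ler1n ltnW.
rewrite /= ger0_norm// ger0_norm// mulrDl mul1r ler_wpDr// natrM -!mulrA ler_wpM2l//.
rewrite mulrCA mulrC ler_pdivlMr//.
have := eb n n1; rewrite -(ler_nat R) !natrX.
rewrite -ler_ln ?posrE ?exprn_gt0 ?ltr0n ?(ltn_trans _ n1)//.
by rewrite !lnXn ?ltr0n ?(ltn_trans _ n1)// -[ln 2 *+ _]mulr_natl -[ln _ *+ _]mulr_natl.
Unshelve. all: by end_near.
Qed.

(** * Counters estimating the l1 norm of the biases *)

Lemma leq_absz_sum (I : Type) (r : seq I) (P : pred I) (F : I -> int) :
  (`|(\sum_(i <- r | P i) F i)%R| <= \sum_(i <- r | P i) `|F i|)%N.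
Proof. elim/big_rec2: _ => // i x y _; lia. Qed.

Lemma bias_norm_le (k n : nat) (f : cube k -> bool) (Psi : seq (constraint k n)) :
  (\sum_j `|bias f Psi j| <= size Psi * (k * 2 ^ k))%N.
Proof.
apply: leq_trans (_ : \sum_j \sum_(c <- Psi) \sum_(i < k | (val c i).1 == j) 2 ^ k <= _)%N.
  apply: leq_sum => j _; apply: leq_trans (leq_absz_sum _ _ _) _.
  apply: leq_sum => c _; apply: leq_trans (leq_absz_sum _ _ _) _.
  apply: leq_sum => i _.
  by rewrite abszM abszX exp1n muln1 int_weight_le.
rewrite exchange_big/= -sum1_size big_distrl/=; apply: leq_sum => c _.
rewrite mul1n -[X in (_ <= X * _)%N]card_ord -sum_nat_const.
by rewrite [leqRHS](partition_big (fun i => (val c i).1) predT).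
Qed.

Lemma Posz_sum (I : Type) (r : seq I) (P : pred I) (F : I -> nat) :
  (\sum_(i <- r | P i) F i)%N%:Z = \sum_(i <- r | P i) (F i)%:Z.
Proof. exact: (big_morph Posz PoszD). Qed.

(** The share of one literal in the random combination of the biases: linearity lets the stream be
    processed without storing any bias. *)
Definition literal_incr (k n Q : nat) (f : cube k -> bool)
    (u : {ffun 'I_n -> bool * 'I_Q}) (c : constraint k n) (i : 'I_k) : int :=
  int_weight f i * (-1) ^+ (val c i).2 *
  ((-1) ^+ (u (val c i).1).1 * (magnitude (u (val c i).1).2)%:Z).

(* [None] counts constraints; [Some (t, true)] and [Some (t, false)] count the
   negative and positive parts of the increments of the [t]-th combination. *)
Definition counter_incr (k n T Q : nat) (f : cube k -> bool)
    (w : {ffun 'I_T -> {ffun 'I_n -> bool * 'I_Q}}) (c : constraint k n)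
    (l : option ('I_T * bool)) : nat :=
  if l is Some (t, neg) then
    (\sum_(i < k | ((literal_incr f (w t) c i < 0)%R == neg))
      `|literal_incr f (w t) c i|)%N
  else 1%N.

Lemma counter_diff (k n T Q : nat) (f : cube k -> bool)
    (w : {ffun 'I_T -> {ffun 'I_n -> bool * 'I_Q}}) (Psi : seq (constraint k n)) (t : 'I_T) :
  (\sum_(c <- Psi) counter_incr f w c (Some (t, false)))%N%:Z -
  (\sum_(c <- Psi) counter_incr f w c (Some (t, true)))%N%:Z =
  random_comb (bias f Psi) (w t).
Proof.
have -> : random_comb (bias f Psi) (w t) = \sum_j (bias f Psi j)%:~R *
    ((-1) ^+ (w t j).1 * (magnitude (w t j).2)%:Z).
  by apply: eq_bigr => j _; rewrite intz.
rewrite -bias_exchange !Posz_sum -sumrB; apply: eq_bigr => c _.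
have incrE neg : counter_incr f w c (Some (t, neg)) = (\sum_(i < k)
    if (literal_incr f (w t) c i < 0)%R == neg then `|literal_incr f (w t) c i| else 0)%N.
  by rewrite -big_mkcond.
rewrite !incrE !Posz_sum -sumrB; apply: eq_bigr => i _; rewrite intz.
by rewrite -/(literal_incr f (w t) c i); case: ltP => z0 /=; lia.
Qed.

Lemma counter_incr_le (k n T Q : nat) (f : cube k -> bool)
    (w : {ffun 'I_T -> {ffun 'I_n -> bool * 'I_Q}}) (c : constraint k n)
    (l : option ('I_T * bool)) :
  (0 < Q)%N -> (counter_incr f w c l <= k.+1 * 2 ^ k * Q)%N.
Proof.
move=> Q0; case: l => [[t neg]|] /=; last by rewrite !muln_gt0 expn_gt0 Q0.
apply: leq_trans (_ : \sum_(i < k) 2 ^ k * Q <= _)%N; last first.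
  by rewrite sum_nat_const card_ord mulnA !leq_mul.
rewrite big_mkcond; apply: leq_sum => i _; case: ifP => // _.
rewrite !abszM !abszX !exp1n muln1 mul1n leq_mul ?int_weight_le//.
exact: leq_div.
Qed.

Lemma bias_gap_sketch (R : realType) (k n : nat) (f : cube k -> bool) (m L s : nat) :
  (m * (k.+1 * 2 ^ k) < 2 ^ L)%N -> s = (46 * L)%N ->
  exists alg : streaming_alg (constraint k n) s, composable alg /\
    forall Psi : seq (constraint k n), (0 < size Psi)%N -> (size Psi <= m)%N ->
      ((size Psi <= 2 * \sum_j `|bias f Psi j|)%N -> 2 / 3 <= prob_output R alg Psi true) /\
      ((330 * \sum_j `|bias f Psi j| <= size Psi)%N -> 2 / 3 <= prob_output R alg Psi false).
Proof.
(* 11 is the least [T] with [(9/10) ^ T <= 1/3]. [Q] is a power of two so that the random choices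
   correspond exactly to bit strings. *)
move=> mL sL; pose T := 11%N; pose Q := (2 ^ L)%N.
have Q0 : (0 < Q)%N by rewrite expn_gt0.
pose W1 := {ffun 'I_n -> bool * 'I_Q}; pose W := {ffun 'I_T -> W1}.
pose I : finType := option ('I_T * bool).
have cardW : #|{: W}| = (2 ^ (L.+1 * n * T))%N.
  by rewrite !card_ffun card_prod card_bool !card_ord /Q -expnS -!expnM mulnA.
have cardI : #|{: I}| = 23%N by rewrite card_option card_prod card_ord card_bool.
pose D (_ : W) (F : {ffun I -> nat}) := [exists t : 'I_T,
  (F None)%:Z <= 2 * `|(F (Some (t, false)))%:Z - (F (Some (t, true)))%:Z|].
(* There are 23 = 1 + 2 * 11 counters. Each needs [2 * L] bits, as its total is below
   [2 ^ L * Q]. *)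
have sE : s = (2 * L * #|{: I}|)%N by rewrite sL cardI; lia.
have [alg [compo algE]] := counter_sketch (@counter_incr k n T Q f) D cardW sE.
exists alg; split=> // Psi Psi0 Psim.
set N := (\sum_j _)%N.
have NZ : N%:Z = \sum_j `|bias f Psi j|.
  by rewrite /N Posz_sum; apply: eq_bigr => j _; rewrite abszE.
have NQ : (N < Q)%N.
  apply: leq_ltn_trans mL; apply: leq_trans (bias_norm_le _ _) _.
  by rewrite leq_mul// leq_mul.
have small (w : W) (i : I) : (\sum_(c <- Psi) counter_incr f w c i < 2 ^ (2 * L))%N.
  apply: leq_ltn_trans (_ : m * (k.+1 * 2 ^ k) * Q < _)%N; last first.
    by rewrite mul2n -addnn expnD ltn_pmul2r.
  apply: leq_trans (_ : \sum_(c <- Psi) k.+1 * 2 ^ k * Q <= _)%N.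
    by apply: leq_sum => c _; exact: counter_incr_le.
  by rewrite big_const_seq count_predT iter_addn_0 mulnC -[leqRHS]mulnA leq_mul2r Psim orbT.
pose A (w : W1) := (size Psi)%:Z <= 2 * `|random_comb (bias f Psi) w|.
have DE w : D w [ffun i => \sum_(c <- Psi) counter_incr f w c i]%N = [exists t, A (w t)].
  apply: eq_existsb => t; rewrite !ffunE counter_diff /A.
  by rewrite /= sum1_size.
have W10 : (0 < #|{: W1}|)%N.
  by rewrite card_ffun card_prod card_bool card_ord expn_gt0 muln_gt0 Q0.
have W0 : (0 < #|{: W}|)%N by rewrite cardW expn_gt0.
have out ans : prob_output R alg Psi ans =
    prob R (fun w : W => [exists t, A (w t)] == ans).
  by rewrite algE//; apply: eq_mean => w; rewrite DE.
have notA : prob R (fun w : W => ~~ [exists t, A (w t)]) = (1 - prob R A) ^+ T.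
  rewrite -probC// -[X in _ ^+ X](card_ord T) -prodr_const -prob_forall.
  by apply: eq_mean => w; rewrite negb_exists.
have outF : prob_output R alg Psi false = (1 - prob R A) ^+ T.
  by rewrite out -notA; apply: eq_mean => w; case: [exists _, _].
have outT : prob_output R alg Psi true = 1 - (1 - prob R A) ^+ T.
  rewrite -notA -probC//; rewrite out; apply: eq_mean => w /=.
  by rewrite negbK; case: [exists _, _].
rewrite outF outT; set q := prob R A.
have q1 : q <= 1 by rewrite -subr_ge0 -probC// mean_ge0.
split=> Nm.
  have N0 : (0 < N)%N by lia.
  have q10 : 10^-1 <= q.
    apply: le_trans (random_comb_tail_ge R NZ N0 NQ) _.
    by apply: le_prob => w; rewrite /A; lia.
  have : (1 - q) ^+ T <= (9 / 10) ^+ T.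
    by rewrite lerXn2r// ?nnegrE; lra.
  by rewrite /T; lra.
have m0 : 0 < (size Psi)%:R :> R by rewrite ltr0n.
(* With threshold [size Psi / 2] the tail bound is [10 * N / size Psi <= 10 / 330], and
   [(32/33) ^ 11] still exceeds 2/3. *)
have qN : q <= 33^-1.
  apply: le_trans (_ : prob R (fun w => (size Psi)%:R / 2 <=
    `|(random_comb (Q := Q) (bias f Psi) w)%:~R| :> R) <= _).
    apply: le_prob => w; rewrite /A -(ler_int R) rmorphM/= intr_norm.
    by rewrite ler_pdivrMr// mulrC.
  apply: le_trans (random_comb_tail_le _ _ _) _ => //; first by rewrite divr_gt0.
  rewrite -NZ ler_pdivrMr ?divr_gt0//.
  move: Nm; rewrite -(ler_nat R) natrM -[N%:~R]/(N%:R); lra.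
apply: le_trans (_ : (32 / 33) ^+ T <= _); first by rewrite /T; lra.
by rewrite lerXn2r// ?nnegrE; lra.
Qed.

(** The linear form is odd, so [x] and its antipode never both satisfy [f]. This leaves room for the
    gap [rho + eps < 1 - eps]. *)
Lemma rho_le_half (R : realType) (k : nat) (f : cube k -> bool)
    (hf : forall x : cube k,
       f x = sign (\sum_(i < k) fourier R f [set i]%SET * pm R (x i))) :
  rho R f <= 2^-1.
Proof.
pose opp (x : cube k) : cube k := [ffun i => ~~ x i].
have oppK : involutive opp by move=> x; apply/ffunP => i; rewrite !ffunE negbK.
have f_opp x : ((f x)%:R + (f (opp x))%:R <= 1 :> R).
  have : ~~ (f x && f (opp x)).
    rewrite !hf /sign [X in _ && (_ < X)](eq_bigr (fun i =>
        - (fourier R f [set i]%SET * pm R (x i)))).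
      by rewrite sumrN oppr_gt0; case: ltgtP.
    by move=> i _; rewrite /pm ffunE signrN mulrN.
  by case: (f x); case: (f (opp x)) => //= _; rewrite ?addr0 ?add0r.
rewrite rhoE -(ler_pM2l (_ : 0 < 2)) ?ltr0n// divff ?pnatr_eq0//.
rewrite mulrCA ler_pdivrMl ?exprn_gt0// mulr1.
have -> : 2 * \sum_x (f x)%:R = \sum_x ((f x)%:R + (f (opp x))%:R) :> R.
  by rewrite big_split/= mulr_natl mulr2n [X in _ + X = _](reindex_inj (can_inj oppK)).
apply: le_trans (ler_sum _ (fun x _ => f_opp x)) _.
by rewrite sumr_const card_cube natrX.
Qed.

Theorem theorem5p1 (R : realType) (k : nat) (f : cube k -> bool)
    (hf : forall x : cube k,
       f x = sign (\sum_(i < k) fourier R f [set i]%SET * pm R (x i))) :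
  sketching_approximable R f (O_log R).
Proof.
(* [M] dominates the loss factor of each case, [1 + K] for large values and [2 ^+ k * (1 + 3 ^+ k)]
   for small ones; [eta] brings both below 1/400, and the gap parameter is [eta ^+ 2]. *)
pose K : R := k%:R * 2 ^+ k; pose M : R := 2 ^+ k * (1 + 3 ^+ k) + (1 + K).
have K0 : 0 <= K by rewrite mulr_ge0.
have C0 : 0 <= 2 ^+ k * (1 + 3 ^+ k) :> R by rewrite mulr_ge0// addr_ge0.
have M1 : 1 <= M by rewrite /M; lra.
have M0 : 0 < M by lra.
pose eta : R := (400 * M)^-1.
have etaM : eta * M = 400^-1 by rewrite /eta; field; rewrite gt_eqF.
have eta0 : 0 < eta by rewrite invr_gt0; apply: mulr_gt0; rewrite ?ltr0n.
have eta1 : eta <= 400^-1 by rewrite -etaM ler_peMr// ltW.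
have eta01 : 0 <= eta <= 1 by lra.
have etaC : eta * (2 ^+ k * (1 + 3 ^+ k)) <= 400^-1.
  by rewrite -etaM ler_wpM2l ?(ltW eta0)// /M; lra.
have etaK : eta * (1 + K) <= 400^-1 by rewrite -etaM ler_wpM2l ?(ltW eta0)// /M; lra.
have eps_small : eta ^+ 2 <= 400^-1.
  by rewrite expr2 (le_trans _ eta1)// ler_piMr ?(ltW eta0)//; lra.
have epsK : eta ^+ 2 * (1 + K) <= 400^-1.
  rewrite expr2 -mulrA (le_trans _ etaK)// ler_piMl//; last by lra.
  by rewrite mulr_ge0 ?(ltW eta0)//; lra.
exists (eta ^+ 2); split; first by rewrite exprn_gt0.
  by have := rho_le_half hf; lra.
move=> p; pose c := (k.+1 * 2 ^ k)%N.
exists (fun n => 46 * (trunc_log 2 (p.[n] * c)).+1)%N; split.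
  exact: O_log_trunc_log.
suff alg_ex n : exists alg : streaming_alg (constraint k n)
      (46 * (trunc_log 2 (p.[n] * c)).+1)%N,
    composable alg /\ solves f (1 - eta ^+ 2) (rho R f + eta ^+ 2) p.[n] alg.
  by exists (fun n => projT1 (cid (alg_ex n))) => n; case: cid.
have pL : (p.[n] * c < 2 ^ (trunc_log 2 (p.[n] * c)).+1)%N by exact: trunc_log_ltn.
have [alg [compo algP]] := bias_gap_sketch R n f pL erefl.
exists alg; split=> // Psi Psi0 Psim; have [large small] := algP Psi Psi0 Psim.
have m0 : 0 < (size Psi)%:R :> R by rewrite ltr0n.
set N := (\sum_j _)%N in large small.
have NZ : \sum_j `|bias f Psi j| = N%:Z.
  by rewrite /N Posz_sum; apply: eq_bigr => j _; rewrite abszE.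
split=> val.
  apply: large.
  (* The default 0 of the maximum lies below [1 - eta ^+ 2], so an actual assignment attains this
     bound. *)
  have [a aval] : exists a, 1 - eta ^+ 2 <= sat_fraction R f Psi a.
    apply/existsP; apply: contraLR val; rewrite negb_exists => /forallP h.
    rewrite -ltNge; apply: bigmax_lt => [|a _]; first by lra.
    by rewrite ltNge h.
  move: aval; rewrite /sat_fraction ler_pdivlMr// => aval.
  have := bias_norm_ge hf Psi a; rewrite NZ -(ler_int R) !(rmorphB, rmorphM, rmorphD)/=.
  rewrite -!pmulrn natrX -/K.
  rewrite -(ler_nat R) natrM.
  set s := (count _ _)%:R in aval *; set m := (size Psi)%:R in aval m0 *.
  (* [N >= s * (1 + K) - K * m >= m - eta ^+ 2 * (1 + K) * m], which is well above [m / 2]. *)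
  move=> h; have h1 : (1 - eta ^+ 2) * m * (1 + K) <= s * (1 + K) by rewrite ler_wpM2r//; lra.
  have h2 : eta ^+ 2 * (1 + K) * m <= 400^-1 * m by rewrite ler_wpM2r ?(ltW m0).
  by lra.
apply: small.
have := csp_value_rounding f eta01 Psi0; rewrite NZ -[(Posz _)%:~R]/(_%:R).
rewrite -(ler_nat R) natrM; set m := (size Psi)%:R in m0 *; set v : R := N%:R.
move=> le_val.
(* Cancelling [rho] and dividing by [eta] gives [v < eta * 2 ^+ k * (1 + 3 ^+ k) * m <= m / 400],
   which is within [m / 330]. *)
have h : eta * v / (2 ^+ k * m) < eta * (eta * (1 + 3 ^+ k)) by lra.
move: h; rewrite -mulrA ltr_pM2l// ltr_pdivrMr ?mulr_gt0 ?exprn_gt0// => h.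
have : eta * (2 ^+ k * (1 + 3 ^+ k)) * m <= 400^-1 * m by rewrite ler_wpM2r ?(ltW m0).
by lra.
Qed.
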